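(* Let $n\ge2$, let $\Sigma\in\mathbb{R}^{n\times n}$ be a covariance matrix with $|\Sigma|\neq0$, let $\boldsymbol{\mu}\in\mathbb{R}^n$, let $\mathcal{U}$ be an $n$-dimensional Thorin measure, and let $\mathbf{s}\in\mathbb{S}_{**}$. Consider the condition $$(\ast)\qquad\int_{(0,\infty)^n}\mathfrak{A}(\mathbf{s},\mathbf{u})\,\frac{\mathcal{U}(\mathrm{d}\mathbf{u})}{\mathfrak{D}(\mathbf{s},\mathbf{u})}<\infty.$$ (i) If $\mathcal{U}(\{\mathbf{u}\in(0,\infty)^n:\|\mathbf{u}\|\le a\})=0$ for some $a>0$, then $(\ast)$ is equivalent to $$\int_{\{\mathbf{u}\in(0,\infty)^n:\|\mathbf{u}\|>a\}}\frac{\|\mathbf{u}\|}{\|\mathbf{s}\|^{n-1}_{(\mathbf{u}\diamond\Sigma)^{-1}}(\prod_{k=1}^nu_k)^{1/2}}\,\mathcal{U}(\mathrm{d}\mathbf{u})<\infty.$$ (ii) If $\mathcal{U}((\mathbb{S}_{++})^C)=0$, then $(\ast)$ is equivalent to $$\int_{\mathbb{S}_{++}}\|\mathbf{s}\|^{1-n}_{(\mathbf{u}\diamond\Sigma)^{-1}}\Big(\prod_{k=1}^nu_k\Big)^{-1/2}\,\mathcal{U}(\mathrm{d}\mathbf{u})<\infty.$$ (iii) If $\mathcal{U}((0,\infty)^n\cap\cdot)=\sum_{k=1}^m\int_{(0,\infty)}\boldsymbol{\delta}_{v\mathbf{u}_k}(\cdot)\,\mathcal{U}_k(\mathrm{d}v)$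 for some $m\ge1$, $\mathbf{u}_k\in(0,\infty)^n$ and univariate Thorin measures $\mathcal{U}_k$, then $(\ast)$ is equivalent to $$\int_{(1,\infty)}v^{1/2}\,\mathcal{U}_k(\mathrm{d}v)<\infty\qquad\text{for all }1\le k\le m.$$
   Context: Vectors are row vectors; $\|\mathbf{x}\|_M^2=\mathbf{x}M\mathbf{x}'$; $\|\cdot\|$ is the Euclidean norm, $|M|$ the determinant, $\boldsymbol{\delta}_{\mathbf{y}}$ the Dirac measure at $\mathbf{y}$. A covariance matrix is a real symmetric nonnegative definite matrix. $\mathbb{S}=\{\mathbf{x}\in\mathbb{R}^n:\|\mathbf{x}\|=1\}$, $\mathbb{S}_{**}=\mathbb{S}\cap(\mathbb{R}\setminus\{0\})^n$, $\mathbb{S}_{++}=\mathbb{S}\cap(0,\infty)^n$; the complement in (ii) is relative to $[0,\infty)^n_*=[0,\infty)^n\setminus\{\mathbf{0}\}$. An $n$-dimensional Thorin measure is a nonnegative Borel measure $\mathcal{U}$ on $[0,\infty)^n_*$ with $\int(1+\ln^-\|\mathbf{u}\|)\wedge(1/\|\mathbf{u}\|)\,\mathcal{U}(\mathrm{d}\mathbf{u})<\infty$, where $\ln^-r=\max\{-\ln r,0\}$; univariate means $n=1$. For $\mathbf{u}\in(0,\infty)^n$: $\mathbf{u}\diamond\boldsymbol{\mu}=(u_1\mu_1,\dots,u_n\mu_n)$ and $\mathbf{u}\diamond\Sigma=(\min\{u_k,u_l\}\Sigma_{kl})_{k,l}$, which is an invertible covariance matrix if $\Sigma$ is. Define $$\mathfrak{A}(\mathbf{s},\mathbf{u})=\big\{(2\|\mathbf{u}\|^2+\|\mathbf{u}\diamond\boldsymbol{\mu}\|^2_{(\mathbf{u}\diamond\Sigma)^{-1}})\|\mathbf{s}\|^2_{(\mathbf{u}\diamond\Sigma)^{-1}}\big\}^{1/2},\qquad\mathfrak{D}(\mathbf{s},\mathbf{u})=\|\mathbf{s}\|^n_{(\mathbf{u}\diamond\Sigma)^{-1}}|\mathbf{u}\diamond\Sigma|^{1/2}.$$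 *)

(* Defs.v *)
From HB Require Import structures.
From mathcomp Require Import all_boot all_order all_algebra.
From mathcomp Require Import all_classical all_reals all_analysis.

Set Implicit Arguments.
Unset Strict Implicit.
Unset Printing Implicit Defensive.

Import Order.TTheory GRing.Theory Num.Theory.
Import numFieldNormedType.Exports.

Local Open Scope classical_set_scope.
Local Open Scope ring_scope.

Notation borel_rV R n := (g_sigma_algebraType (@open 'rV[R]_n)).

(* The norm `|x| that the library puts on 'rV[R]_n is the maximum norm. *)
Definition enorm (R : realType) (n : nat) (x : 'rV[R]_n) : R :=
  Num.sqrt (\sum_(i < n) x 0 i ^+ 2).

Definition sqnorm_mx (R : realType) (n : nat) (M : 'M[R]_n) (x : 'rV[R]_n) : R :=
  (x *m M *m x^T) 0 0.

Definition norm_mx (R : realType) (n : nat) (M : 'M[R]_n) (x : 'rV[R]_n) : R :=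
  Num.sqrt (sqnorm_mx M x).

Definition covariance_mx (R : realType) (n : nat) (M : 'M[R]_n) : Prop :=
  M^T = M /\ forall x : 'rV[R]_n, 0 <= sqnorm_mx M x.

Definition pos_orthant (R : realType) (n : nat) : set 'rV[R]_n :=
  [set u | forall i, 0 < u 0 i].
Arguments pos_orthant : clear implicits.

Definition nonneg_orthant_star (R : realType) (n : nat) : set 'rV[R]_n :=
  [set u | (forall i, 0 <= u 0 i) /\ u <> 0].
Arguments nonneg_orthant_star : clear implicits.

Definition sphere (R : realType) (n : nat) : set 'rV[R]_n :=
  [set x | enorm x = 1].
Arguments sphere : clear implicits.

Definition sphere_nonzero (R : realType) (n : nat) : set 'rV[R]_n :=
  sphere R n `&` [set x | forall i, x 0 i <> 0].
Arguments sphere_nonzero : clear implicits.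

Definition sphere_pos (R : realType) (n : nat) : set 'rV[R]_n :=
  sphere R n `&` pos_orthant R n.
Arguments sphere_pos : clear implicits.

Definition ln_minus (R : realType) (r : R) : R := Num.max (- ln r) 0.

(* A Borel measure on the nonnegative orthant without the origin is represented
   by its extension by zero to the whole space. *)
Definition thorin_measure (R : realType) (n : nat)
    (U : {measure set (borel_rV R n) -> \bar R}) : Prop :=
  U (~` nonneg_orthant_star R n) = 0%E /\
  (\int[U]_(u in nonneg_orthant_star R n)
     (Num.min (1 + ln_minus (enorm u)) (1 / enorm u))%:E < +oo)%E.

Definition diamond_rV (R : realType) (n : nat) (u mu : 'rV[R]_n) : 'rV[R]_n :=
  \row_k (u 0 k * mu 0 k).

Definition diamond_mx (R : realType) (n : nat) (u : 'rV[R]_n) (Sigma : 'M[R]_n)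
    : 'M[R]_n :=
  \matrix_(k, l) (Num.min (u 0 k) (u 0 l) * Sigma k l).

Definition frakA (R : realType) (n : nat) (mu : 'rV[R]_n) (Sigma : 'M[R]_n)
    (s u : 'rV[R]_n) : R :=
  Num.sqrt ((2 * enorm u ^+ 2
              + sqnorm_mx (invmx (diamond_mx u Sigma)) (diamond_rV u mu))
            * sqnorm_mx (invmx (diamond_mx u Sigma)) s).

Definition frakD (R : realType) (n : nat) (Sigma : 'M[R]_n) (s u : 'rV[R]_n) : R :=
  norm_mx (invmx (diamond_mx u Sigma)) s ^+ n
  * Num.sqrt (\det (diamond_mx u Sigma)).

Definition star_condition (R : realType) (n : nat) (mu : 'rV[R]_n)
    (Sigma : 'M[R]_n) (U : {measure set (borel_rV R n) -> \bar R})
    (s : 'rV[R]_n) : Prop :=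
  (\int[U]_(u in pos_orthant R n)
     (frakA mu Sigma s u / frakD Sigma s u)%:E < +oo)%E.

(* Main.v *)
Require Import Defs.
From HB Require Import structures.
From mathcomp Require Import all_boot all_order all_algebra.
From mathcomp Require Import all_classical all_reals all_analysis.
From mathcomp Require Import measurable_realfun.
From mathcomp Require Import perm ring lra.

Set Implicit Arguments.
Unset Strict Implicit.
Unset Printing Implicit Defensive.

Import Order.TTheory GRing.Theory Num.Theory.
Import numFieldNormedType.Exports.

Local Open Scope classical_set_scope.
Local Open Scope ring_scope.

(** For [u] in the open orthant put [M = diamond_mx u Sigma]. Since [Sigma] is
    positive definite, so is [M], and the factor [norm_mx (invmx M) s] of
    [frakA] cancels one of those of [frakD]: the integrand of the star
    condition is

      [sqrt (2 |u|^2 + q(u)) / (N(u)^(n-1) * sqrt (det M))],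

    where [N(u)] is the norm of [s] for [invmx M] and [q(u)] is the squared norm
    of [diamond_rV u mu] for [invmx M] ([frakA_frakDE]). Two estimates with
    constants independent of [u] reduce everything to [|u|], [N(u)] and the
    product of the coordinates:

    - [det M] is comparable to the product of the [u_k]
      ([diamond_mx_det_comparable]);
    - [0 <= q(u) <= C |u|] ([diamond_drift_bound]).

    Both come from one coercivity inequality, that of [diamond_mx_coercive]:
    [sum_k u_k x_k^2 <= T * x M x'] for some [T] depending only on [Sigma]. A
    positive semidefinite matrix [P] stays so when its entries are multiplied by
    [min(u_k, u_l)] ([diamond_mx_psd], a layer-cake decomposition of the
    minimum), and coercivity is this fact for [P = T Sigma - 1].

    On a set where [|u|] is bounded below, [2 |u|^2 + q(u)] is therefore
    comparable to [|u|^2], and the integrand to that of (i), which on the unit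
    sphere is that of (ii). Both parts follow from [star_condition_comparable],
    which also discards a null set. In (iii), the integral is a sum over the
    rays through the [u_k] ([integral_ray_sum]). All the quantities are
    homogeneous in [u], and the powers of [v] cancel along a ray except under
    the first square root: the integrand at [v *: u] is a constant times
    [sqrt (2 |u|^2 v + q(u))] ([frakA_frakD_ray]). This is bounded for [v <= 1],
    where a Thorin measure has finite mass, and comparable to [sqrt v] for
    [v > 1] ([thorin_ray_integrable]). *)

(** * Positive definite matrices *)

Definition posdef (R : realType) (n : nat) (M : 'M[R]_n) : Prop :=
  forall x : 'rV[R]_n, x != 0 -> 0 < sqnorm_mx M x.

Lemma sqnorm_mxE (R : realType) (n : nat) (M : 'M[R]_n) (x : 'rV[R]_n) :
  sqnorm_mx M x = \sum_k \sum_l x 0 k * x 0 l * M k l.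
Proof.
rewrite /sqnorm_mx mxE exchange_big /=; apply: eq_bigr => l _.
rewrite !mxE big_distrl /=; apply: eq_bigr => k _.
by rewrite mulrAC.
Qed.

Lemma sqnorm_mxD (R : realType) (n : nat) (M N : 'M[R]_n) (x : 'rV[R]_n) :
  sqnorm_mx (M + N) x = sqnorm_mx M x + sqnorm_mx N x.
Proof. by rewrite /sqnorm_mx mulmxDr mulmxDl mxE. Qed.

Lemma sqnorm_mxZ (R : realType) (n : nat) c (M : 'M[R]_n) (x : 'rV[R]_n) :
  sqnorm_mx (c *: M) x = c * sqnorm_mx M x.
Proof. by rewrite /sqnorm_mx -scalemxAr -scalemxAl mxE. Qed.

Lemma sqnorm_mx_diag (R : realType) (n : nat) (d x : 'rV[R]_n) :
  sqnorm_mx (diag_mx d) x = \sum_k d 0 k * x 0 k ^+ 2.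
Proof.
rewrite sqnorm_mxE; apply: eq_bigr => k _.
rewrite (bigD1 k) //= big1 ?addr0 => [|l lk]; rewrite mxE.
  by rewrite eqxx mulr1n mulrC expr2.
by rewrite eq_sym (negbTE lk) mulr0n mulr0.
Qed.

Lemma posdef_unitmx (R : realType) (n : nat) (M : 'M[R]_n) :
  posdef M -> M \in unitmx.
Proof.
move=> Mpd; rewrite unitmxE unitfE; apply/det0P => -[x x0 xM].
by have := Mpd _ x0; rewrite /sqnorm_mx xM mul0mx mxE ltxx.
Qed.

Lemma posdef_ge0 (R : realType) (n : nat) (M : 'M[R]_n) (x : 'rV[R]_n) :
  posdef M -> 0 <= sqnorm_mx M x.
Proof.
have [->|x0 Mpd] := eqVneq x 0; last exact/ltW/Mpd.
by rewrite /sqnorm_mx trmx0 mulmx0 mxE.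
Qed.

Lemma sqnorm_invmx (R : realType) (n : nat) (M : 'M[R]_n) (x : 'rV[R]_n) :
  M \in unitmx -> sqnorm_mx (invmx M) x = sqnorm_mx M (x *m invmx M).
Proof.
move=> Munit; rewrite /sqnorm_mx mulmxKV //.
by rewrite -[(x *m invmx M) *m _]trmxK trmx_mul trmxK mxE.
Qed.

Lemma posdef_invmx (R : realType) (n : nat) (M : 'M[R]_n) :
  posdef M -> posdef (invmx M).
Proof.
move=> Mpd x x0; have Munit := posdef_unitmx Mpd.
rewrite sqnorm_invmx //; apply: Mpd; apply: contra x0 => /eqP xM.
by rewrite -[x](mulmxKV Munit) xM mul0mx.
Qed.

(** The determinant of [t M + (1 - t) 1] is a polynomial in [t] which equals [1]
    at [0] and has no root in [[0, 1]], since the matrix stays positive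
    definite. *)
Lemma posdef_det_gt0 (R : realType) (n : nat) (M : 'M[R]_n) :
  posdef M -> 0 < \det M.
Proof.
move=> Mpd.
pose P : 'M[{poly R}]_n := 'X *: map_mx polyC M + (1 - 'X) *: 1%:M.
have PE t : (\det P).[t] = \det (t *: M + (1 - t) *: 1%:M).
  rewrite -horner_evalE -det_map_mx; congr (\det _).
  apply/matrixP => i j; rewrite !mxE /= horner_evalE.
  by rewrite !(hornerE, hornerMn).
have Ppd t : 0 <= t <= 1 -> \det (t *: M + (1 - t) *: 1%:M) != 0.
  move=> /andP[t0 t1]; rewrite -unitfE -unitmxE; apply: posdef_unitmx => x x0.
  rewrite sqnorm_mxD !sqnorm_mxZ.
  have xM := Mpd _ x0.
  have : 0 < sqnorm_mx 1%:M x.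
    rewrite -diag_const_mx sqnorm_mx_diag.
    under eq_bigr do rewrite mxE mul1r.
    rewrite lt_neqAle sumr_ge0 ?andbT => [|k _]; last exact: sqr_ge0.
    rewrite eq_sym psumr_eq0 => [|k _]; last exact: sqr_ge0.
    apply: contra x0 => /allP x0; apply/eqP/rowP => k; rewrite mxE.
    by have := x0 k; rewrite mem_index_enum sqrf_eq0 => /(_ isT)/eqP.
  nra.
have := Ppd 1; rewrite ler01 lexx subrr scale0r addr0 scale1r => /(_ isT) M0.
rewrite lt_neqAle eq_sym M0 leNgt /=; apply/negP => Mneg.
have ivt01 : (- \det P).[0] <= 0 <= (- \det P).[1].
  rewrite !hornerN !PE subrr subr0 !scale0r !scale1r addr0 add0r det1.
  by rewrite oppr_le0 ler01 oppr_ge0 ltW.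
have [t t01] := poly_ivt ler01 ivt01.
by rewrite /root hornerN oppr_eq0 PE; apply/negP/Ppd; move: t01.
Qed.

(** Leibniz formula: for each permutation the weights multiply to
    [\prod_i w i ^+ 2], whatever the permutation is. *)
Lemma det_norm_le (R : realType) (n : nat) (A : 'M[R]_n) (c : R)
    (w : 'I_n -> R) :
  (forall i j, `|A i j| <= c * (w i * w j)) ->
  `|\det A| <= (n`!)%:R * c ^+ n * \prod_i w i ^+ 2.
Proof.
move=> Aw; rewrite /determinant (le_trans (ler_norm_sum _ _ _)) //.
have -> : (n`!)%:R * c ^+ n * \prod_i w i ^+ 2 =
    \sum_(sg : 'S_n) (c ^+ n * \prod_i w i ^+ 2).
  by rewrite sumr_const -[RHS]mulr_natl mulrA -card_Sn; congr (_%:R * _ * _).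
apply: ler_sum => sg _.
rewrite normrM normrX normrN1 expr1n mul1r normr_prod.
have -> : c ^+ n * \prod_i w i ^+ 2 = \prod_i (c * (w i * w (sg i))).
  rewrite [RHS]big_split /= prodr_const card_ord; congr (_ * _).
  rewrite [RHS]big_split /= [X in _ = _ * X](_ : _ = \prod_i w i) ?prodrXl ?expr2 //.
  exact/esym/(reindex_inj (@perm_inj _ sg)).
by apply: ler_prod => i _; rewrite normr_ge0 Aw.
Qed.

(** * Bounds for the matrix with entries min(u_k, u_l) Sigma_kl *)

(** Layer-cake decomposition: if [t] is the least positive [u_k] and [S] is the
    set of indices where [u] is positive, then
    [min(u_k, u_l) = t 1_S(k) 1_S(l) + min(v_k, v_l)] with [v = u - t 1_S >= 0],
    which has fewer positive coordinates than [u]. The first term contributes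
    the quadratic form of [P] at [x] cut off outside [S]. *)
Lemma diamond_mx_psd (R : realType) (n : nat) (P : 'M[R]_n) (u : 'rV[R]_n) :
  (forall x, 0 <= sqnorm_mx P x) -> (forall k, 0 <= u 0 k) ->
  forall x, 0 <= sqnorm_mx (diamond_mx u P) x.
Proof.
move=> Ppsd; have [m] := ubnP #|[pred k | 0 < u 0 k]|.
elim: m u => // m IH u um u0 x.
have [k0 uk0|u_le0] := pickP [pred k | 0 < u 0 k]; last first.
  rewrite sqnorm_mxE big1 // => k _; rewrite big1 // => l _.
  have -> : u = 0.
    apply/rowP => j; rewrite mxE; apply/eqP.
    by rewrite eq_le u0 andbT leNgt; have /= -> := u_le0 j.
  by rewrite !mxE minxx mul0r mulr0.
have [k1 uk1 uk1_min] := @arg_minP _ _ _ k0 [pred k | 0 < u 0 k] (u 0) uk0.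
set t := u 0 k1 in uk1_min.
have t0 : 0 < t by [].
pose S k : R := (0 < u 0 k)%R%:R.
pose v : 'rV[R]_n := \row_k (u 0 k - t * S k).
have v0 k : 0 <= v 0 k.
  rewrite mxE /S; case: (ltP 0 (u 0 k)) => uk.
    by rewrite mulr1 subr_ge0; apply: uk1_min.
  by rewrite mulr0 subr0.
have vm : (#|[pred k | (0 < v 0 k)%R]| < m)%N.
  rewrite -ltnS (leq_trans _ um) // ltnS; apply: proper_card.
  apply/properP; split; last first.
    by exists k1; rewrite !inE // mxE /S -/t t0 mulr1 subrr ltxx.
  apply/fintype.subsetP => k; rewrite !inE mxE /S.
  by case: (ltP 0 (u 0 k)) => // uk; rewrite mulr0 subr0 ltNge uk.
have -> : sqnorm_mx (diamond_mx u P) x =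
    t * sqnorm_mx P (\row_k (S k * x 0 k)) + sqnorm_mx (diamond_mx v P) x.
  rewrite !sqnorm_mxE mulr_sumr -big_split; apply: eq_bigr => k _ /=.
  rewrite mulr_sumr -big_split; apply: eq_bigr => l _ /=.
  rewrite !mxE.
  have -> : Num.min (u 0 k) (u 0 l) =
      t * (S k * S l) + Num.min (u 0 k - t * S k) (u 0 l - t * S l).
    have := u0 k; have := u0 l; rewrite /S.
    case: (ltP 0 (u 0 k)) => uk; case: (ltP 0 (u 0 l)) => ul uk' ul' /=;
      rewrite ?mulr1 ?mulr0 ?subr0 ?add0r //.
    - by rewrite addr_minr !subrKC.
    - have utk : t <= u 0 k by exact: uk1_min.
      by rewrite !min_r ?(le_trans ul) // subr_ge0.
    - have utl : t <= u 0 l by exact: uk1_min.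
      by rewrite !min_l ?(le_trans uk) // subr_ge0.
  ring.
by rewrite addr_ge0 // ?IH // mulr_ge0 // ltW.
Qed.

(** If [y_k] is row [k] of [invmx Sigma], then
    [x Sigma y_k' = x_k], so the nonnegativity of the form at [x - t y_k] bounds
    [x_k ^ 2] by a multiple of [x Sigma x']. *)
Lemma covariance_mx_coercive (R : realType) (n : nat) (Sigma : 'M[R]_n) :
  covariance_mx Sigma -> \det Sigma <> 0 ->
  exists2 T : R, 0 < T &
    forall x : 'rV[R]_n, \sum_k x 0 k ^+ 2 <= T * sqnorm_mx Sigma x.
Proof.
move=> [Sym Spsd] /eqP det0.
have Sunit : Sigma \in unitmx by rewrite unitmxE unitfE.
pose y k : 'rV[R]_n := row k (invmx Sigma).
have yS k : y k *m Sigma = delta_mx 0 k by rewrite -row_mul mulVmx // row1.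
have xSy (x : 'rV[R]_n) k : (x *m Sigma *m (y k)^T) 0 0 = x 0 k.
  rewrite -mulmxA -[Sigma]Sym -trmx_mul yS trmx_delta.
  by rewrite -colE mxE.
have coord (x : 'rV[R]_n) k :
    x 0 k ^+ 2 <= (sqnorm_mx Sigma (y k) + 1) * sqnorm_mx Sigma x.
  set c := sqnorm_mx Sigma (y k).
  have c0 : 0 <= c by exact: Spsd.
  (* The minimum is at x_k / c, but c could vanish a priori. *)
  pose t := x 0 k / (c + 1).
  have := Spsd (x - t *: y k).
  have -> : sqnorm_mx Sigma (x - t *: y k) =
      sqnorm_mx Sigma x - 2 * t * x 0 k + t ^+ 2 * c.
    rewrite /sqnorm_mx [(_ - _)^T]linearB /= [(_ *: _)^T]linearZ /=.
    rewrite !(mulmxBl, mulmxBr) -!scalemxAr -!scalemxAl.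
    rewrite !mxE.
    have ySx : (y k *m Sigma *m x^T) 0 0 = x 0 k by rewrite yS -rowE !mxE.
    have := xSy x k; move: ySx; rewrite /c /sqnorm_mx !mxE => -> ->.
    ring.
  have tc : t * (c + 1) = x 0 k by rewrite divfK // gt_eqF // ltr_wpDl.
  by nra.
pose T : R := \sum_k (sqnorm_mx Sigma (y k) + 1) + 1.
exists T => [|x].
  by rewrite ltr_wpDl // sumr_ge0 // => k _; rewrite addr_ge0 // Spsd.
rewrite mulrDl mul1r mulr_suml (le_trans (ler_sum _ (fun k _ => coord x k))) //.
by rewrite lerDl Spsd.
Qed.

(** The hypothesis says that [T Sigma - 1] is positive semidefinite, and
    [diamond_mx u (T Sigma - 1) = T (diamond_mx u Sigma) - diag u]. *)
Lemma diamond_mx_coercive (R : realType) (n : nat) (Sigma : 'M[R]_n) (T : R)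
    (u : 'rV[R]_n) :
  (forall x : 'rV[R]_n, \sum_k x 0 k ^+ 2 <= T * sqnorm_mx Sigma x) ->
  pos_orthant R n u ->
  forall x : 'rV[R]_n,
    \sum_k u 0 k * x 0 k ^+ 2 <= T * sqnorm_mx (diamond_mx u Sigma) x.
Proof.
move=> hT u0 x.
have P0 y : 0 <= sqnorm_mx (T *: Sigma + (-1) *: diag_mx (const_mx 1)) y.
  rewrite sqnorm_mxD !sqnorm_mxZ sqnorm_mx_diag mulN1r subr_ge0.
  by under eq_bigr do rewrite mxE mul1r.
have := diamond_mx_psd P0 (fun k => ltW (u0 k)) x.
have -> : diamond_mx u (T *: Sigma + (-1) *: diag_mx (const_mx 1)) =
    T *: diamond_mx u Sigma + (-1) *: diag_mx u.
  apply/matrixP => i j; rewrite !mxE; case: eqP => [->|_].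
    by rewrite minxx !mulr1n; ring.
  by rewrite !mulr0n; ring.
by rewrite sqnorm_mxD !sqnorm_mxZ sqnorm_mx_diag mulN1r subr_ge0.
Qed.

Lemma diamond_mx_posdef (R : realType) (n : nat) (Sigma : 'M[R]_n) (u : 'rV[R]_n) :
  covariance_mx Sigma -> \det Sigma <> 0 -> pos_orthant R n u ->
  posdef (diamond_mx u Sigma).
Proof.
move=> cov det0 u0 x x0; have [T T0 hT] := covariance_mx_coercive cov det0.
rewrite -(pmulr_rgt0 _ T0); apply: lt_le_trans (diamond_mx_coercive hT u0 x).
have [k xk] : exists k, x 0 k != 0.
  apply/existsP; apply: contraR x0; rewrite negb_exists => /forallP xk.
  by apply/eqP/rowP => k; rewrite mxE; apply/eqP; rewrite -[_ == _]negbK.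
rewrite (bigD1 k) //= ltr_pwDl //.
  by rewrite mulr_gt0 // exprn_even_gt0.
by apply: sumr_ge0 => l _; rewrite mulr_ge0 ?sqr_ge0 // ltW.
Qed.

(** The entries of [diamond_mx u Sigma] are at most [b sqrt(u_k u_l)], since
    [min(u_k, u_l) <= sqrt(u_k u_l)]; those of its inverse are at most
    [T / sqrt(u_k u_l)] by coercivity. So [det_norm_le] bounds both the
    determinant and its inverse. *)
Lemma diamond_mx_det_comparable (R : realType) (n : nat) (Sigma : 'M[R]_n) :
  covariance_mx Sigma -> \det Sigma <> 0 ->
  exists2 C : R, 0 < C & forall u : 'rV[R]_n, pos_orthant R n u ->
    \det (diamond_mx u Sigma) <= C * \prod_k u 0 k /\
    \prod_k u 0 k <= C * \det (diamond_mx u Sigma).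
Proof.
move=> cov det0; have [T T0 hT] := covariance_mx_coercive cov det0.
pose b : R := \sum_k \sum_l `|Sigma k l|.
have b0 : 0 <= b by apply: sumr_ge0 => k _; apply: sumr_ge0.
have Sb k l : `|Sigma k l| <= b.
  rewrite /b (bigD1 k) //= (bigD1 l) //= -addrA lerDl addr_ge0 ?sumr_ge0 //.
  by move=> ? _; rewrite sumr_ge0.
exists ((n`!)%:R * b ^+ n + (n`!)%:R * T ^+ n).
  by rewrite ltr_wpDl ?mulr_ge0 ?exprn_ge0 // mulr_gt0 ?exprn_gt0.
move=> u u0; set M := diamond_mx u Sigma.
have Mpd : posdef M by exact: diamond_mx_posdef.
have Munit := posdef_unitmx Mpd.
have det_gt0 := posdef_det_gt0 Mpd.
have prod_gt0 : 0 < \prod_k u 0 k by apply: prodr_gt0 => k _; exact: u0.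
have sqrtK k : Num.sqrt (u 0 k) ^+ 2 = u 0 k by rewrite sqr_sqrtr // ltW.
have sqrt_gt0 k : 0 < Num.sqrt (u 0 k) by rewrite sqrtr_gt0 u0.
have up : `|\det M| <= (n`!)%:R * b ^+ n * \prod_k u 0 k.
  under [X in _ <= _ * X]eq_bigr do rewrite -sqrtK.
  apply: det_norm_le => k l; rewrite mxE normrM mulrC ler_pM //.
  rewrite ger0_norm; last by rewrite le_min !ltW.
  have [ukl|ulk] := leP (u 0 k) (u 0 l).
    by rewrite -{1}sqrtK expr2 ler_pM2l // ler_sqrt // ltW.
  by rewrite -{1}sqrtK expr2 ler_pM2r // ler_sqrt ltW.
have lo : `|\det (invmx M)| <= (n`!)%:R * T ^+ n * (\prod_k u 0 k)^-1.
  rewrite -prodfV.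
  under [X in _ <= _ * X]eq_bigr do rewrite -sqrtK -exprVn.
  apply: det_norm_le => k l.
  have := diamond_mx_coercive hT u0 (row k (invmx M)).
  set x := row k (invmx M).
  have -> : sqnorm_mx M x = x 0 k.
    by rewrite /sqnorm_mx -row_mul mulVmx // row1 -rowE !mxE.
  have term j : u 0 j * x 0 j ^+ 2 <= \sum_k u 0 k * x 0 k ^+ 2.
    rewrite (bigD1 j) //= lerDl sumr_ge0 // => i _.
    by rewrite mulr_ge0 ?sqr_ge0 // ltW.
  move=> hx; have hk := le_trans (term k) hx; have hl := le_trans (term l) hx.
  have -> : invmx M k l = x 0 l by rewrite mxE.
  rewrite -invfM ler_pdivlMr ?mulr_gt0 //.
  (* x is row k of the inverse, so x M x' = x_k: coercivity bounds first the
     diagonal entry x_k by T / u_k, then x_l through u_l x_l^2 <= T x_k. *)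
  have uxk : u 0 k * x 0 k <= T.
    have [xk_le0|xk_gt0] := leP (x 0 k) 0.
      by rewrite (le_trans _ (ltW T0)) // mulr_ge0_le0 // ltW.
    by rewrite -(ler_pM2r xk_gt0) -mulrA -expr2.
  have lhs_ge0 : 0 <= `|x 0 l| * (Num.sqrt (u 0 k) * Num.sqrt (u 0 l)).
    by rewrite mulr_ge0 // mulr_ge0 // ltW.
  rewrite -ler_sqr ?nnegrE ?lhs_ge0 ?(ltW T0) //.
  rewrite !exprMn !sqrtK real_normK ?num_real //.
  have ulk := ler_wpM2l (ltW T0) uxk.
  have ukl := ler_wpM2l (ltW (u0 k)) hl.
  by lra.
have K0 (c : R) : 0 <= c -> 0 <= (n`!)%:R * c ^+ n.
  by move=> c0; rewrite mulr_ge0 ?exprn_ge0.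
split.
  apply: (le_trans (ler_norm _)); apply: (le_trans up).
  rewrite ler_pM2r // lerDl.
  by rewrite K0 // ltW.
move: lo; rewrite det_inv normfV gtr0_norm // ler_pdivlMr // ler_pdivrMl // => lo.
rewrite (le_trans lo) // mulrC ler_pM2r // lerDr K0 // ltW.
Qed.

(** If [x] is [diamond_rV u mu] times the inverse of [M], then the quantity [q] to
    bound is both [x M x'] and [\sum_k u_k x_k mu_k]. By
    [2 T x_k mu_k <= x_k^2 + T^2 mu_k^2] and coercivity, [q] is at most
    [T \sum_k u_k mu_k^2]. *)
Lemma diamond_drift_bound (R : realType) (n : nat) (Sigma : 'M[R]_n) (mu : 'rV[R]_n) :
  covariance_mx Sigma -> \det Sigma <> 0 ->
  exists2 C : R, 0 <= C & forall u : 'rV[R]_n, pos_orthant R n u ->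
    0 <= sqnorm_mx (invmx (diamond_mx u Sigma)) (diamond_rV u mu) <= C * enorm u.
Proof.
move=> cov det0; have [T T0 hT] := covariance_mx_coercive cov det0.
exists (T * \sum_k mu 0 k ^+ 2) => [|u u0].
  by rewrite (mulr_ge0 (ltW T0)) // sumr_ge0 // => k _; rewrite sqr_ge0.
set M := diamond_mx u Sigma.
have Munit : M \in unitmx by exact/posdef_unitmx/diamond_mx_posdef.
pose x := diamond_rV u mu *m invmx M.
set q := sqnorm_mx _ _.
have qE : q = sqnorm_mx M x by exact: sqnorm_invmx.
have qx : q = \sum_k u 0 k * (x 0 k * mu 0 k).
  rewrite /q /sqnorm_mx -/x mxE; apply: eq_bigr => k _.
  by rewrite !mxE mulrCA.
have coer := diamond_mx_coercive hT u0 x; rewrite -/M -qE in coer.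
have q0 : 0 <= q.
  rewrite -(pmulr_rge0 _ T0) (le_trans _ coer) // sumr_ge0 // => k _.
  by rewrite mulr_ge0 ?sqr_ge0 // ltW.
have umu : q <= T * \sum_k u 0 k * mu 0 k ^+ 2.
  have : 2 * T * q <= T * q + T ^+ 2 * \sum_k u 0 k * mu 0 k ^+ 2.
    rewrite (le_trans _ (lerD coer (lexx _))) //.
    rewrite qx !mulr_sumr -big_split; apply: ler_sum => k _ /=.
    have uk := ltW (u0 k); have := mulr_ge0 uk (sqr_ge0 (x 0 k - T * mu 0 k)).
    by lra.
  by move=> hq; rewrite -(ler_pM2l T0); lra.
rewrite q0 (le_trans umu) // -mulrA ler_pM2l // mulr_suml.
apply: ler_sum => k _; rewrite mulrC ler_wpM2l ?sqr_ge0 //.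
rewrite -(ger0_norm (ltW (u0 k))) -sqrtr_sqr ler_wsqrtr //.
rewrite (bigD1 k) //= lerDl sumr_ge0 // => l _; exact: sqr_ge0.
Qed.

(** * Measurability on row vectors *)

(** The identity [x^-1 = x * (x^2)^-1] holds at [0] too, and reduces the claim to
    a power function on nonnegative numbers. *)
Lemma measurable_invr (R : realType) :
  measurable_fun [set: R] (fun x : R => x^-1).
Proof.
have -> : (fun x : R => x^-1) = (fun x => x * (x ^+ 2) `^ (-1)).
  apply/funext => x; rewrite powR_inv1 ?sqr_ge0 //.
  have [->|x0] := eqVneq x 0; first by rewrite invr0 mul0r.
  by rewrite expr2 invfM mulrA divff // mul1r.
apply: measurable_funM => //.
exact: (measurableT_comp (measurable_powR (-1)) (exprn_measurable 2)).
Qed.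

Lemma measurable_sqrtr (R : realType) :
  measurable_fun [set: R] (@Num.sqrt R).
Proof. apply: continuous_measurable_fun; exact: sqrt_continuous. Qed.

Lemma measurable_funV d (T : measurableType d) (R : realType) (D : set T)
    (f : T -> R) :
  measurable_fun D f -> measurable_fun D (fun x => (f x)^-1).
Proof. exact: (measurableT_comp (@measurable_invr R)). Qed.

Lemma measurable_fun_sqrt d (T : measurableType d) (R : realType) (D : set T)
    (f : T -> R) :
  measurable_fun D f -> measurable_fun D (fun x => Num.sqrt (f x)).
Proof. exact: (measurableT_comp (@measurable_sqrtr R)). Qed.

Lemma measurable_coord (R : realType) (n : nat) (i : 'I_n) :
  measurable_fun [set: borel_rV R n] (fun u : 'rV[R]_n => u 0 i).
Proof.
apply: (measurability _ (RGenOpens.measurableE R)) => _ [_ [a [b ->] <-]].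
apply: sub_sigma_algebra; rewrite setTI.
apply: open_comp => [u _|]; first exact: coord_continuous.
exact: interval_open.
Qed.

Lemma measurable_det d (T : measurableType d) (R : realType) (D : set T)
    (n : nat) (A : T -> 'M[R]_n) :
  (forall i j, measurable_fun D (fun x => A x i j)) ->
  measurable_fun D (fun x => \det (A x)).
Proof.
move=> mA; apply: measurable_sum => sg; apply: measurable_funM => //.
by apply: measurable_prod => i _; exact: mA.
Qed.

Lemma measurable_invmx d (T : measurableType d) (R : realType) (D : set T)
    (n : nat) (A : T -> 'M[R]_n) :
  (forall x, D x -> A x \in unitmx) ->
  (forall i j, measurable_fun D (fun x => A x i j)) ->
  forall i j, measurable_fun D (fun x => invmx (A x) i j).
Proof.
move=> uA mA i j.
apply: (eq_measurable_fun
  (fun x => (\det (A x))^-1 * ((-1) ^+ (j + i) * \det (row' j (col' i (A x)))))).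
  by move=> x /set_mem Dx; rewrite /invmx uA // !mxE.
apply: measurable_funM; first exact/measurable_funV/measurable_det.
apply: measurable_funM => //; apply: measurable_det => k l.
by apply: eq_measurable_fun (mA (lift j k) (lift i l)) => x _; rewrite !mxE.
Qed.

Lemma measurable_sqnorm_mx d (T : measurableType d) (R : realType) (D : set T)
    (n : nat) (A : T -> 'M[R]_n) (x : T -> 'rV[R]_n) :
  (forall i j, measurable_fun D (fun t => A t i j)) ->
  (forall i, measurable_fun D (fun t => x t 0 i)) ->
  measurable_fun D (fun t => sqnorm_mx (A t) (x t)).
Proof.
move=> mA mx.
apply: (eq_measurable_fun
  (fun t => \sum_k \sum_l x t 0 k * x t 0 l * A t k l)).
  by move=> t _; rewrite sqnorm_mxE.
apply: measurable_sum => k; apply: measurable_sum => l.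
by apply: measurable_funM => //; exact: measurable_funM.
Qed.

Lemma measurable_pos_orthant (R : realType) (n : nat) :
  measurable (pos_orthant R n : set (borel_rV R n)).
Proof.
have -> : pos_orthant R n =
    \bigcap_(i in [set: 'I_n]) [set u : 'rV[R]_n | 0 < u 0 i].
  by apply/seteqP; split => u /= u0 i; [move=> _|]; exact: u0.
apply: fin_bigcap_measurable; first exact: finite_finset.
move=> i _; rewrite -[X in measurable X]setTI.
have -> : [set u : 'rV[R]_n | 0 < u 0 i] =
  (fun u : 'rV[R]_n => u 0 i) @^-1` `]0, +oo[%classic.
  by apply/seteqP; split => u /=; rewrite in_itv /= andbT.
exact: measurable_coord.
Qed.

Lemma measurable_enorm (R : realType) (n : nat) :
  measurable_fun [set: borel_rV R n] (@enorm R n).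
Proof.
apply/measurable_fun_sqrt/measurable_sum => i.
apply: measurable_funX; exact: measurable_coord.
Qed.

Lemma enorm_eq0 (R : realType) (n : nat) (u : 'rV[R]_n) :
  (enorm u == 0) = (u == 0).
Proof.
rewrite /enorm sqrtr_eq0 le_eqVlt ltNge sumr_ge0 ?orbF => [|i _]; last first.
  exact: sqr_ge0.
rewrite psumr_eq0 => [|i _]; last exact: sqr_ge0.
apply/allP/eqP => [u0|-> i _]; last by rewrite mxE expr0n /= eqxx.
by apply/rowP => i; have := u0 i; rewrite mxE mem_index_enum sqrf_eq0 => /(_ isT)/eqP.
Qed.

(** In [nonneg_orthant_star] the inequality [u <> 0] is between coordinate
    functions, not between matrices; a condition on the norm is also plainly
    measurable. *)
Lemma nonneg_orthant_starE (R : realType) (n : nat) :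
  nonneg_orthant_star R n =
    [set u : 'rV[R]_n | (forall i, 0 <= u 0 i) /\ enorm u <> 0].
Proof.
apply/seteqP; split => u /= [u0 un0]; split => //.
  move=> /eqP; rewrite enorm_eq0 => /eqP uE; apply: un0; rewrite uE.
  by apply/funext => i; apply/funext => j; rewrite mxE.
move=> uE; apply: un0; apply/eqP; rewrite enorm_eq0; apply/eqP.
by apply/rowP => j; rewrite uE mxE.
Qed.

Lemma measurable_nonneg_orthant_star (R : realType) (n : nat) :
  measurable (nonneg_orthant_star R n : set (borel_rV R n)).
Proof.
have -> : nonneg_orthant_star R n =
    (\bigcap_(i in [set: 'I_n]) [set u : 'rV[R]_n | 0 <= u 0 i])
      `\` (@enorm R n @^-1` [set 0]).
  rewrite nonneg_orthant_starE; apply/seteqP; split => u /= [u0 un0]; split => //.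
  - by move=> i _; exact: u0.
  - by move=> i; exact: u0.
apply: measurableD; last first.
  by rewrite -[X in measurable X]setTI; exact: measurable_enorm.
apply: fin_bigcap_measurable; first exact: finite_finset.
move=> i _; rewrite -[X in measurable X]setTI.
have -> : [set u : 'rV[R]_n | 0 <= u 0 i] =
  (fun u : 'rV[R]_n => u 0 i) @^-1` `[0, +oo[%classic.
  by apply/seteqP; split => u /=; rewrite in_itv /= andbT.
exact: measurable_coord.
Qed.

Lemma measurable_sphere_pos (R : realType) (n : nat) :
  measurable (sphere_pos R n : set (borel_rV R n)).
Proof.
apply: measurableI; last exact: measurable_pos_orthant.
rewrite -[X in measurable X]setTI.
exact: (@measurable_enorm R n measurableT _ (measurable_set1 1)).
Qed.

Lemma integral_lty_of_le d (T : measurableType d) (R : realType)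
    (mu : {measure set T -> \bar R}) (D : set T) (f g : T -> R) (c : R) :
  measurable D -> measurable_fun D f -> measurable_fun D g -> 0 <= c ->
  (forall x, D x -> 0 <= f x) -> (forall x, D x -> 0 <= g x) ->
  (forall x, D x -> f x <= c * g x) ->
  (\int[mu]_(x in D) (g x)%:E < +oo)%E -> (\int[mu]_(x in D) (f x)%:E < +oo)%E.
Proof.
move=> mD mf mg c0 f0 g0 fg goo.
have mEf : measurable_fun D (EFin \o f) by exact/measurable_EFinP.
have mEg : measurable_fun D (EFin \o g) by exact/measurable_EFinP.
have Eg0 x : D x -> (0 <= (g x)%:E)%E by move=> Dx; rewrite lee_fin g0.
apply: (@le_lt_trans _ _ (\int[mu]_(x in D) (c%:E * (g x)%:E))%E).
  by apply: ge0_le_integral => //; exact: measurable_funeM.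
rewrite ge0_integralZl_EFin //.
by rewrite lte_mul_pinfty ?lee_fin.
Qed.

(** * The integrand of the star condition *)

Lemma frakA_frakDE (R : realType) (n : nat) (Sigma : 'M[R]_n)
    (mu s u : 'rV[R]_n) :
  (0 < n)%N -> posdef (diamond_mx u Sigma) -> s != 0 ->
  frakA mu Sigma s u / frakD Sigma s u =
    Num.sqrt (2 * enorm u ^+ 2
              + sqnorm_mx (invmx (diamond_mx u Sigma)) (diamond_rV u mu))
    / (norm_mx (invmx (diamond_mx u Sigma)) s ^+ n.-1
       * Num.sqrt (\det (diamond_mx u Sigma))).
Proof.
move=> n0 Mpd s0; rewrite /frakA /frakD.
set M := diamond_mx u Sigma; set q := sqnorm_mx _ (diamond_rV _ _).
have Ms : 0 < sqnorm_mx (invmx M) s by exact: posdef_invmx.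
rewrite sqrtrM; last first.
  have q0 : 0 <= q by exact/posdef_ge0/posdef_invmx.
  by have := sqr_ge0 (enorm u); lra.
rewrite -[Num.sqrt (sqnorm_mx (invmx M) s)]/(norm_mx (invmx M) s).
have N0 : norm_mx (invmx M) s != 0 by rewrite gt_eqF // sqrtr_gt0.
have -> : norm_mx (invmx M) s ^+ n =
    norm_mx (invmx M) s * norm_mx (invmx M) s ^+ n.-1.
  by rewrite -exprS prednK.
by rewrite -[X in _ / X]mulrA invfM mulrA mulfK.
Qed.

(** The integrand of (i), and of (ii) where [enorm u = 1]. *)
Definition comparison_density (R : realType) (n : nat) (Sigma : 'M[R]_n)
    (s u : 'rV[R]_n) : R :=
  enorm u / (norm_mx (invmx (diamond_mx u Sigma)) s ^+ n.-1
             * Num.sqrt (\prod_(k < n) u 0 k)).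

(** The lower bound [a] on the norm turns the linear bound of
    [diamond_drift_bound] into a quadratic one: [B |u| <= (B / a) |u|^2]. *)
Lemma density_comparable (R : realType) (n : nat) (Sigma : 'M[R]_n)
    (mu s : 'rV[R]_n) (a : R) :
  (0 < n)%N -> covariance_mx Sigma -> \det Sigma <> 0 -> s != 0 -> 0 < a ->
  exists2 K : R, 0 <= K & forall u, pos_orthant R n u -> a <= enorm u ->
    let f := frakA mu Sigma s u / frakD Sigma s u in
    let g := comparison_density Sigma s u in
    f <= K * g /\ g <= K * f.
Proof.
move=> n0 cov det0 s0 a0.
have [C C0 detC] := diamond_mx_det_comparable cov det0.
have [B B0 driftB] := diamond_drift_bound mu cov det0.
pose L := 2 + B / a.
have L1 : 1 <= L by rewrite /L; have := divr_ge0 B0 (ltW a0); lra.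
exists (Num.sqrt C * L) => [|u u0 au f g].
  by rewrite mulr_ge0 ?sqrtr_ge0 // (le_trans ler01).
have Mpd := diamond_mx_posdef cov det0 u0.
rewrite {}/f frakA_frakDE // {}/g /comparison_density.
have [det1 det2] := detC _ u0; have /andP[q0 qB] := driftB _ u0.
set M := diamond_mx u Sigma in Mpd det1 det2 q0 qB *.
set e := enorm u in au qB *; set q := sqnorm_mx _ (diamond_rV _ _) in q0 qB *.
have det_gt0 := posdef_det_gt0 Mpd; rewrite -/M in det_gt0.
have prod_gt0 : 0 < \prod_k u 0 k by apply: prodr_gt0 => k _; exact: u0.
have P0 : 0 < norm_mx (invmx M) s ^+ n.-1.
  by rewrite exprn_gt0 // sqrtr_gt0 posdef_invmx.
set P := norm_mx _ _ ^+ _ in P0 *.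
have e0 : 0 < e by exact: lt_le_trans au.
set E := Num.sqrt (2 * e ^+ 2 + q).
have eE : e <= E.
  rewrite -[e]gtr0_norm // -sqrtr_sqr ler_wsqrtr //.
  by have := sqr_ge0 e; lra.
have EL : E <= L * e.
  rewrite -[L * e]ger0_norm ?mulr_ge0 ?(ltW e0) ?(le_trans ler01) //.
  rewrite -sqrtr_sqr ler_wsqrtr //.
  have Be : B * e <= B / a * e ^+ 2.
    rewrite expr2 mulrA ler_wpM2r ?(ltW e0) // -mulrA ler_peMr //.
    by rewrite mulrC ler_pdivlMr // mul1r.
  have LL : L * e ^+ 2 <= (L * e) ^+ 2.
    by rewrite exprMn ler_wpM2r ?sqr_ge0 // expr2 ler_peMl // (le_trans ler01).
  by rewrite /L in LL *; lra.
set d := Num.sqrt (\det M); set p := Num.sqrt (\prod_k u 0 k).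
have d0 : 0 < d by rewrite sqrtr_gt0.
have p0 : 0 < p by rewrite sqrtr_gt0.
have dp : d <= Num.sqrt C * p by rewrite -(sqrtrM _ (ltW C0)) ler_wsqrtr.
have pd : p <= Num.sqrt C * d by rewrite -(sqrtrM _ (ltW C0)) ler_wsqrtr.
have r0 : 0 <= Num.sqrt C := sqrtr_ge0 C.
set r := Num.sqrt C in dp pd r0 *.
have E0 : 0 < E by exact: lt_le_trans eE.
split.
  rewrite ler_pdivrMr ?mulr_gt0 //.
  have -> : r * L * (e / (P * p)) * (P * d) = L * e * (r * d) / p.
    by field; rewrite !gt_eqF.
  by rewrite ler_pdivlMr // ler_pM // ltW.
rewrite ler_pdivrMr ?mulr_gt0 //.
have -> : r * L * (E / (P * d)) * (P * p) = L * E * (r * p) / d.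
  by field; rewrite !gt_eqF.
rewrite ler_pdivlMr //; apply: ler_pM; rewrite ?(ltW e0) ?(ltW d0) //.
by rewrite (le_trans eE) // ler_peMl // ltW.
Qed.

Lemma frakA_frakD_ge0 (R : realType) (n : nat) (Sigma : 'M[R]_n)
    (mu s u : 'rV[R]_n) :
  0 <= frakA mu Sigma s u / frakD Sigma s u.
Proof.
by rewrite divr_ge0 ?sqrtr_ge0 // mulr_ge0 ?exprn_ge0 ?sqrtr_ge0.
Qed.

Lemma measurable_diamond_mx (R : realType) (n : nat) (Sigma : 'M[R]_n)
    (i j : 'I_n) :
  measurable_fun [set: borel_rV R n]
    (fun u : 'rV[R]_n => diamond_mx u Sigma i j).
Proof.
under eq_fun do rewrite mxE.
by apply: measurable_funM => //; apply: measurable_minr; exact: measurable_coord.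
Qed.

Lemma measurable_invmx_diamond (R : realType) (n : nat) (Sigma : 'M[R]_n) :
  covariance_mx Sigma -> \det Sigma <> 0 ->
  forall i j, measurable_fun (pos_orthant R n : set (borel_rV R n))
    (fun u => invmx (diamond_mx u Sigma) i j).
Proof.
move=> cov det0; apply: measurable_invmx => [u u0|i j].
  exact/posdef_unitmx/diamond_mx_posdef.
by apply: measurable_funTS; exact: measurable_diamond_mx.
Qed.

Lemma measurable_frakA_frakD (R : realType) (n : nat) (Sigma : 'M[R]_n)
    (mu s : 'rV[R]_n) :
  covariance_mx Sigma -> \det Sigma <> 0 ->
  measurable_fun (pos_orthant R n : set (borel_rV R n))
    (fun u => frakA mu Sigma s u / frakD Sigma s u).
Proof.
move=> cov det0; have minv := measurable_invmx_diamond cov det0.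
have mcoord i : measurable_fun (pos_orthant R n : set (borel_rV R n))
    (fun u : 'rV[R]_n => u 0 i).
  by apply: measurable_funTS; exact: measurable_coord.
apply: measurable_funM.
  apply/measurable_fun_sqrt/measurable_funM; last exact: measurable_sqnorm_mx.
  apply: measurable_funD; last first.
    apply: measurable_sqnorm_mx => // i.
    by under eq_fun do rewrite mxE; exact: measurable_funM.
  apply: measurable_funM => //; apply: measurable_funX.
  by apply: measurable_funTS; exact: measurable_enorm.
apply/measurable_funV/measurable_funM.
  by apply: measurable_funX; apply/measurable_fun_sqrt/measurable_sqnorm_mx.
apply/measurable_fun_sqrt/measurable_det => i j.
by apply: measurable_funTS; exact: measurable_diamond_mx.
Qed.

Lemma measurable_comparison_density (R : realType) (n : nat) (Sigma : 'M[R]_n)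
    (s : 'rV[R]_n) :
  covariance_mx Sigma -> \det Sigma <> 0 ->
  measurable_fun (pos_orthant R n : set (borel_rV R n))
    (comparison_density Sigma s).
Proof.
move=> cov det0; have minv := measurable_invmx_diamond cov det0.
apply: measurable_funM.
  by apply: measurable_funTS; exact: measurable_enorm.
apply/measurable_funV/measurable_funM.
  by apply: measurable_funX; apply/measurable_fun_sqrt/measurable_sqnorm_mx.
apply/measurable_fun_sqrt/measurable_prod => i _.
by apply: measurable_funTS; exact: measurable_coord.
Qed.

Lemma star_condition_comparable (R : realType) (n : nat) (Sigma : 'M[R]_n)
    (mu s : 'rV[R]_n) (U : {measure set (borel_rV R n) -> \bar R})
    (D : set (borel_rV R n)) (a : R) :
  (0 < n)%N -> covariance_mx Sigma -> \det Sigma <> 0 -> s != 0 -> 0 < a ->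
  measurable D -> D `<=` pos_orthant R n -> (forall u, D u -> a <= enorm u) ->
  U (pos_orthant R n `\` D) = 0%E ->
  star_condition mu Sigma U s <->
  (\int[U]_(u in D) (comparison_density Sigma s u)%:E < +oo)%E.
Proof.
move=> n0 cov det0 s0 a0 mD Dpos Da null.
have mpos := @measurable_pos_orthant R n.
have mf := measurable_frakA_frakD mu s cov det0.
have mg := measurable_comparison_density s cov det0.
have f0 u : 0 <= frakA mu Sigma s u / frakD Sigma s u by exact: frakA_frakD_ge0.
have g0 u : 0 <= comparison_density Sigma s u.
  by rewrite divr_ge0 ?sqrtr_ge0 // mulr_ge0 ?exprn_ge0 ?sqrtr_ge0.
rewrite /star_condition
  (@ge0_negligible_integral _ (borel_rV R n) R U _ (pos_orthant R n `\` D)) //;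
  [|exact: measurableD|exact/measurable_EFinP|by move=> u _; rewrite lee_fin].
have -> : pos_orthant R n `\` (pos_orthant R n `\` D) = D.
  by rewrite setDD; apply/setIidr.
have [K K0 hK] := density_comparable mu n0 cov det0 s0 a0.
by split; apply: integral_lty_of_le K0 _ _ _ => //;
  try (by apply: measurable_funS mpos Dpos _);
  move=> u Du; have [] := hK u (Dpos _ Du) (Da _ Du).
Qed.

(** * Integration along rays *)

Lemma measurable_ray (R : realType) (n : nat) (w : 'rV[R]_n) :
  measurable_fun [set: borel_rV R 1]
    (fun v : 'rV[R]_1 => (v 0 0 *: w : borel_rV R n)).
Proof.
apply: (@measurability _ _ (borel_rV R 1) (borel_rV R n) _ _
  (@open 'rV[R]_n)) => // _ [A oA <-].
apply: sub_sigma_algebra; rewrite setTI.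
apply: open_comp oA => v _.
apply: (@continuous_comp _ _ _ (fun v : 'rV[R]_1 => v 0 0) (fun c : R => c *: w)).
  exact: coord_continuous.
exact: scalel_continuous.
Qed.

Lemma ray_pos_orthant (R : realType) (n : nat) (w : 'rV[R]_n) :
  (0 < n)%N -> pos_orthant R n w ->
  (fun v : 'rV[R]_1 => v 0 0 *: w) @^-1` pos_orthant R n = pos_orthant R 1.
Proof.
move=> n0 w0; apply/seteqP; split => v /= v0 i; last first.
  by rewrite mxE mulr_gt0.
by have := v0 (Ordinal n0); rewrite mxE pmulr_lgt0 // (ord1 i).
Qed.

(** The hypothesis identifies [U], on subsets of the open orthant, with the sum
    of the images of the [Uk k] under [v |-> v *: w k]. *)
Lemma integral_ray_sum (R : realType) (n m : nat) (w : 'I_m -> 'rV[R]_n)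
    (Uk : 'I_m -> {measure set (borel_rV R 1) -> \bar R})
    (U : {measure set (borel_rV R n) -> \bar R}) (f : borel_rV R n -> \bar R) :
  (0 < n)%N -> (0 < m)%N -> (forall k, pos_orthant R n (w k)) ->
  (forall A : set (borel_rV R n), measurable A ->
    U (pos_orthant R n `&` A) =
    (\sum_(k < m) \int[Uk k]_(v in pos_orthant R 1)
       \d_((v 0 0 *: w k)%R : borel_rV R n) A)%E) ->
  measurable_fun (pos_orthant R n : set (borel_rV R n)) f ->
  (forall u, pos_orthant R n u -> 0 <= f u)%E ->
  (\int[U]_(u in pos_orthant R n) f u =
   \sum_(k < m) \int[Uk k]_(v in pos_orthant R 1) f (v 0 0 *: w k)%R)%E.
Proof.
move=> n0; case: m w Uk => // m w Uk _ w0 UE mf f0.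
pose phi k : borel_rV R 1 -> borel_rV R n := fun v => (v : 'rV[R]_1) 0 0 *: w k.
have mphi k : measurable_fun setT (phi k) by exact: measurable_ray.
pose nu_of (j : nat) : {measure set (borel_rV R n) -> \bar R} :=
  pushforward (Uk (inord j)) (phi (inord j)).
pose nu := nu_of (fun j => mphi (inord j)).
have mpos := @measurable_pos_orthant R n.
have mpos1 := @measurable_pos_orthant R 1.
rewrite (eq_measure_integral (msum nu m.+1)) => [|A mA Apos]; last first.
  rewrite -[A](setIidr Apos) UE // /msum; apply: eq_bigr => k _.
  rewrite setIidr // /= /pushforward inord_val.
  transitivity (\int[Uk k]_(v in pos_orthant R 1) (\1_(phi k @^-1` A) v)%:E)%E.
    by apply: eq_integral => v _; rewrite diracE indicE.
  rewrite integral_indic //; last first.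
    by rewrite -[X in measurable X]setTI; exact: (mphi k measurableT).
  congr (Uk k _); apply: setIidl => v Av.
  by rewrite -(ray_pos_orthant n0 (w0 k)); exact: Apos.
rewrite ge0_integral_measure_sum //; apply: eq_bigr => k _.
rewrite /nu /nu_of inord_val (ge0_integral_pushforward (mphi k)) //; last first.
  by move=> u /set_mem; exact: f0.
by rewrite ray_pos_orthant.
Qed.

Lemma diamond_mxZ (R : realType) (n : nat) (c : R) (u : 'rV[R]_n)
    (Sigma : 'M[R]_n) :
  0 <= c -> diamond_mx (c *: u) Sigma = c *: diamond_mx u Sigma.
Proof.
by move=> c0; apply/matrixP => i j; rewrite !mxE -minr_pMr // mulrA.
Qed.

(** Writing [v = r ^+ 2] makes all the square roots of powers of [v] explicit:
    the numerator has a factor [r], the norm of [s] a factor [r^-1], and the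
    square root of the determinant a factor [r ^+ n]. *)
Lemma frakA_frakD_ray (R : realType) (n : nat) (Sigma : 'M[R]_n)
    (mu s u : 'rV[R]_n) (v : R) :
  (0 < n)%N -> posdef (diamond_mx u Sigma) -> s != 0 -> 0 < v ->
  frakA mu Sigma s (v *: u) / frakD Sigma s (v *: u) =
    Num.sqrt (2 * enorm u ^+ 2 * v
              + sqnorm_mx (invmx (diamond_mx u Sigma)) (diamond_rV u mu))
    / (norm_mx (invmx (diamond_mx u Sigma)) s ^+ n.-1
       * Num.sqrt (\det (diamond_mx u Sigma))).
Proof.
move=> n0 Mpd s0 v0; set M := diamond_mx u Sigma in Mpd *.
have vM : diamond_mx (v *: u) Sigma = v *: M by rewrite diamond_mxZ // ltW.
have vMpd : posdef (v *: M) by move=> x /Mpd xM; rewrite sqnorm_mxZ mulr_gt0.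
rewrite frakA_frakDE ?vM // /norm_mx invmxZ ?posdef_unitmx // !sqnorm_mxZ detZ.
set q := sqnorm_mx (invmx M) (diamond_rV u mu).
set N := sqnorm_mx (invmx M) s.
have -> : sqnorm_mx (invmx M) (diamond_rV (v *: u) mu) = v ^+ 2 * q.
  have -> : diamond_rV (v *: u) mu = v *: diamond_rV u mu.
    by apply/rowP => k; rewrite !mxE mulrA.
  by rewrite /q /sqnorm_mx linearZ /= -!scalemxAl -scalemxAr !mxE mulrA.
have -> : enorm (v *: u) ^+ 2 = v ^+ 2 * enorm u ^+ 2.
  rewrite !sqr_sqrtr ?sumr_ge0 // ?mulr_sumr => [|k _|k _]; try exact: sqr_ge0.
  by apply: eq_bigr => k _; rewrite mxE exprMn.
have [r r0 ->] : exists2 r, 0 < r & v = r ^+ 2.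
  by exists (Num.sqrt v); rewrite ?sqrtr_gt0 // sqr_sqrtr // ltW.
have sqrtZ c x : 0 <= c -> Num.sqrt (c ^+ 2 * x) = c * Num.sqrt x.
  by move=> c0; rewrite sqrtrM ?sqr_ge0 // sqrtr_sqr ger0_norm.
have -> : 2 * ((r ^+ 2) ^+ 2 * enorm u ^+ 2) + (r ^+ 2)^-1 * ((r ^+ 2) ^+ 2 * q)
    = r ^+ 2 * (2 * enorm u ^+ 2 * r ^+ 2 + q).
  by field; rewrite gt_eqF.
rewrite -exprVn -exprM mulnC exprM !sqrtZ ?invr_ge0 ?exprn_ge0 ?ltW // exprMn.
have rE : r ^+ n = r * r ^+ n.-1 by rewrite -exprS prednK.
have d0 : 0 < Num.sqrt (\det M) by rewrite sqrtr_gt0 posdef_det_gt0.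
have N0 : 0 < Num.sqrt N ^+ n.-1.
  by rewrite exprn_gt0 // sqrtr_gt0; apply: posdef_invmx.
rewrite rE exprVn; have rn0 : 0 < r ^+ n.-1 by rewrite exprn_gt0.
by field; rewrite !gt_eqF.
Qed.

Lemma enorm1 (R : realType) (v : 'rV[R]_1) : enorm v = `|v 0 0|.
Proof. by rewrite /enorm big_ord1 sqrtr_sqr. Qed.

(** The Thorin integrand is at least [1] on the interval from [0] to [1], so the
    bounded function on the left is always integrable there. Beyond [1] it is
    comparable to [sqrt v]. *)
Lemma thorin_ray_integrable (R : realType)
    (V : {measure set (borel_rV R 1) -> \bar R}) (a b c : R) :
  thorin_measure V -> 0 < a -> 0 <= b -> 0 < c ->
  (\int[V]_(v in pos_orthant R 1) (Num.sqrt (a * (v : 'rV[R]_1) 0 0 + b) / c)%:E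
    < +oo)%E <->
  (\int[V]_(v in pos_orthant R 1 `&` [set v : 'rV[R]_1 | (1 < v 0 0)%R])
    (Num.sqrt ((v : 'rV[R]_1) 0 0))%:E < +oo)%E.
Proof.
move=> [_ Vfin] a0 b0 c0.
have mpos := @measurable_pos_orthant R 1.
have mstar := @measurable_nonneg_orthant_star R 1.
have mcoord : measurable_fun [set: borel_rV R 1] (fun v : 'rV[R]_1 => v 0 0).
  exact: measurable_coord.
pose A : set (borel_rV R 1) :=
  pos_orthant R 1 `&` [set v : 'rV[R]_1 | (1 < v 0 0)%R].
pose B : set (borel_rV R 1) := pos_orthant R 1 `\` [set v : 'rV[R]_1 | (1 < v 0 0)%R].
pose t (v : borel_rV R 1) : R :=
  Num.min (1 + ln_minus (enorm (v : 'rV[R]_1))) (1 / enorm (v : 'rV[R]_1)).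
pose g (v : borel_rV R 1) : R := Num.sqrt (a * (v : 'rV[R]_1) 0 0 + b) / c.
have mgt1 : measurable ([set v : 'rV[R]_1 | (1 < v 0 0)%R] : set (borel_rV R 1)).
  rewrite -[X in measurable X]setTI.
  have -> : [set v : 'rV[R]_1 | 1 < v 0 0] =
      (fun v : 'rV[R]_1 => v 0 0) @^-1` `]1, +oo[%classic.
    by apply/seteqP; split => v /=; rewrite in_itv /= andbT.
  exact: mcoord.
have mA : measurable A by exact: measurableI.
have mB : measurable B by exact: measurableD.
have mg : measurable_fun setT g.
  apply: measurable_funM => //; apply: measurable_fun_sqrt.
  by apply: measurable_funD => //; exact: measurable_funM.
have mt : measurable_fun setT t.
  have me := @measurable_enorm R 1.
  apply: measurable_minr.
    apply: measurable_funD => //; apply: measurable_maxr => //.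
    apply: measurable_funN.
    exact: (measurableT_comp (@measurable_ln R) me).
  by apply: measurable_funM => //; exact: measurable_funV.
have mEg : measurable_fun setT (EFin \o g) by exact/measurable_EFinP.
have g0 v : 0 <= g v by rewrite divr_ge0 ?sqrtr_ge0 // ltW.
have t0 v : 0 <= t v.
  rewrite le_min divr_ge0 ?sqrtr_ge0 // andbT addr_ge0 //.
  by rewrite le_max lexx orbT.
have AB : pos_orthant R 1 = A `|` B :> set (borel_rV R 1) by rewrite setUIDK.
have -> : (\int[V]_(v in pos_orthant R 1)
      (Num.sqrt (a * (v : 'rV[R]_1) 0 0 + b) / c)%:E =
    \int[V]_(v in A) (g v)%:E + \int[V]_(v in B) (g v)%:E)%E.
  rewrite AB ge0_integral_setU //.
  - exact: measurable_funTS.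
  - by move=> v _; rewrite lee_fin g0.
  - by apply/disj_setPS => v [[_ v1] [_ /(_ v1)]].
have Bfin : (\int[V]_(v in B) (g v)%:E < +oo)%E.
  apply: (@integral_lty_of_le _ _ _ V B g t (Num.sqrt (a + b) / c)) => //.
  - exact: measurable_funTS.
  - exact: measurable_funTS.
  - by rewrite divr_ge0 ?sqrtr_ge0 // ltW.
  - move=> v [v0 /negP]; rewrite -leNgt => v1.
    have vt : 1 <= t v.
      have v0' : 0 < (v : 'rV[R]_1) 0 0 by exact: v0.
      rewrite le_min enorm1 gtr0_norm // lerDl le_max lexx orbT /=.
      by rewrite ler_pdivlMr // mul1r.
    apply: (@le_trans _ _ (Num.sqrt (a + b) / c)); last first.
      by rewrite ler_peMr // divr_ge0 ?sqrtr_ge0 // ltW.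
    by rewrite ler_pM2r ?invr_gt0 // ler_wsqrtr // lerD2r ler_piMr // ltW.
  - apply: le_lt_trans Vfin; apply: ge0_subset_integral => //.
    + by apply/measurable_EFinP/measurable_funTS.
    + by move=> v _; rewrite lee_fin t0.
    + move=> v [v0 _]; rewrite nonneg_orthant_starE; split => [i|].
        exact/ltW/v0.
      by rewrite enorm1 => /eqP; rewrite normr_eq0 gt_eqF //; exact: v0.
have ms : measurable_fun A (fun v : 'rV[R]_1 => Num.sqrt (v 0 0)).
  exact/measurable_funTS/measurable_fun_sqrt.
split => [gfin|sfin].
  apply: (@integral_lty_of_le _ _ _ V A _ g (c / Num.sqrt a)) => //.
  - exact: measurable_funTS.
  - by rewrite divr_ge0 ?sqrtr_ge0 // ltW.
  - move=> v [v0 v1].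
    have -> : c / Num.sqrt a * g v
        = Num.sqrt (a * (v : 'rV[R]_1) 0 0 + b) / Num.sqrt a.
      by rewrite /g; field; rewrite !gt_eqF ?sqrtr_gt0.
    rewrite ler_pdivlMr ?sqrtr_gt0 // -sqrtrM ?(ltW (v0 _)) // ler_wsqrtr //.
    by rewrite mulrC lerDl.
  - apply: le_lt_trans gfin; rewrite leeDl // integral_ge0 // => v _.
    by rewrite lee_fin g0.
rewrite lte_add_pinfty //.
apply: (@integral_lty_of_le _ _ _ V A g _ (Num.sqrt (a + b) / c)) sfin => //.
- exact: measurable_funTS.
- by rewrite divr_ge0 ?sqrtr_ge0 // ltW.
- move=> v [v0 v1]; rewrite mulrAC ler_pM2r ?invr_gt0 //.
  have ab0 : 0 <= a + b by rewrite addr_ge0 // ltW.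
  rewrite -sqrtrM // ler_wsqrtr // mulrDl lerD2l ler_peMr //.
  exact: ltW.
Qed.

Theorem proposition3p1 (R : realType) (n : nat) (hn : (2 <= n)%N)
    (Sigma : 'M[R]_n) (hSigma : covariance_mx Sigma) (hdet : \det Sigma <> 0)
    (mu : 'rV[R]_n)
    (U : {measure set (borel_rV R n) -> \bar R}) (hU : thorin_measure U)
    (s : 'rV[R]_n) (hs : sphere_nonzero R n s) :
  (* (i) *)
  (forall a : R, 0 < a ->
    U (pos_orthant R n `&` [set u | enorm u <= a]) = 0%E ->
    (star_condition mu Sigma U s <->
     (\int[U]_(u in pos_orthant R n `&` [set u | (a < enorm u)%R])
        (enorm u / (norm_mx (invmx (diamond_mx u Sigma)) s ^+ n.-1
                    * Num.sqrt (\prod_(k < n) u 0 k)))%:E < +oo)%E))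
  /\
  (* (ii) *)
  (U (nonneg_orthant_star R n `\` sphere_pos R n) = 0%E ->
    (star_condition mu Sigma U s <->
     (\int[U]_(u in sphere_pos R n)
        (norm_mx (invmx (diamond_mx u Sigma)) s ^- n.-1
         * (Num.sqrt (\prod_(k < n) u 0 k))^-1)%:E < +oo)%E))
  /\
  (* (iii) *)
  (forall (m : nat) (uk : 'I_m -> 'rV[R]_n)
      (Uk : 'I_m -> {measure set (borel_rV R 1) -> \bar R}),
    (1 <= m)%N ->
    (forall k, pos_orthant R n (uk k)) ->
    (forall k, thorin_measure (Uk k)) ->
    (forall A : set (borel_rV R n), measurable A ->
      U (pos_orthant R n `&` A) =
      (\sum_(k < m) \int[Uk k]_(v in pos_orthant R 1)
         \d_((v 0 0 *: uk k)%R : borel_rV R n) A)%E) ->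
    (star_condition mu Sigma U s <->
     forall k, (\int[Uk k]_(v in pos_orthant R 1 `&` [set v : 'rV[R]_1 | (1 < v 0 0)%R])
                  (Num.sqrt (v 0 0))%:E < +oo)%E)).
Proof.
have n0 : (0 < n)%N by exact: leq_trans hn.
have s0 : s != 0.
  by apply/eqP => sE; case: hs => _ /(_ (Ordinal n0)); rewrite sE mxE.
have mpos := @measurable_pos_orthant R n.
split=> [a a0 Ua|]; [|split=> [Usph|m w Uk m0 w0 Uk_thorin UE]].
- apply: (star_condition_comparable _ n0 hSigma hdet s0 a0) => //.
  + apply: measurableI => //; rewrite -[X in measurable X]setTI.
    have -> : [set u : 'rV[R]_n | a < enorm u] =
        @enorm R n @^-1` `]a, +oo[%classic.
      by apply/seteqP; split => u /=; rewrite in_itv /= andbT.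
    exact: measurable_enorm.
  + by move=> u [_ /ltW].
  + rewrite -[RHS]Ua; congr (U _); apply/seteqP; split => u /= [u0].
      by move=> un; split => //; rewrite leNgt; apply/negP => ua; apply: un.
    by move=> ua; split => // -[_]; rewrite ltNge ua.
- have msph := @measurable_sphere_pos R n.
  have mstar := @measurable_nonneg_orthant_star R n.
  rewrite (@star_condition_comparable _ _ _ mu _ U (sphere_pos R n) 1) //.
  + suff -> : (\int[U]_(u in sphere_pos R n) (enorm u /
        (norm_mx (invmx (diamond_mx u Sigma)) s ^+ n.-1 *
         Num.sqrt (\prod_(k < n) u 0 k)))%:E =
      \int[U]_(u in sphere_pos R n) (norm_mx (invmx (diamond_mx u Sigma)) s ^- n.-1
         * (Num.sqrt (\prod_(k < n) u 0 k))^-1)%:E)%E by [].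
    apply: eq_integral => u /set_mem[/= u1 _].
    by rewrite u1 div1r invfM.
  + by move=> u [].
  + by move=> u [/= ->].
  + apply: (@subset_measure0 _ _ _ U _ _ _ _ _ Usph); try exact: measurableD.
    move=> u [u0 un]; split => //; rewrite nonneg_orthant_starE; split => [i|].
      exact/ltW/u0.
    move=> /eqP; rewrite enorm_eq0 => /eqP uE.
    by have := u0 (Ordinal n0); rewrite uE mxE ltxx.
- pose f (u : borel_rV R n) := (frakA mu Sigma s u / frakD Sigma s u)%:E.
  have mf : measurable_fun (pos_orthant R n : set (borel_rV R n)) f.
    by apply/measurable_EFinP; exact: measurable_frakA_frakD.
  rewrite /star_condition (integral_ray_sum n0 m0 w0 UE mf); last first.
    by move=> u _; rewrite lee_fin frakA_frakD_ge0.
  have wpd k : posdef (diamond_mx (w k) Sigma) by exact: diamond_mx_posdef.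
  have ray k : (\int[Uk k]_(v in pos_orthant R 1) f (v 0 0 *: w k)%R < +oo)%E <->
      (\int[Uk k]_(v in pos_orthant R 1 `&` [set v : 'rV[R]_1 | (1 < v 0 0)%R])
        (Num.sqrt (v 0 0))%:E < +oo)%E.
    pose M := diamond_mx (w k) Sigma.
    pose a := 2 * enorm (w k) ^+ 2.
    pose b := sqnorm_mx (invmx M) (diamond_rV (w k) mu).
    pose c := norm_mx (invmx M) s ^+ n.-1 * Num.sqrt (\det M).
    have a0 : 0 < a.
      rewrite mulr_gt0 // exprn_gt0 // lt_neqAle sqrtr_ge0 andbT eq_sym enorm_eq0.
      by apply/eqP => wE; have := w0 k (Ordinal n0); rewrite wE mxE ltxx.
    have b0 : 0 <= b by exact/posdef_ge0/posdef_invmx/wpd.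
    have c0 : 0 < c.
      rewrite mulr_gt0 ?exprn_gt0 // sqrtr_gt0; first exact: (posdef_invmx (wpd k)).
      exact: posdef_det_gt0 (wpd k).
    rewrite -(thorin_ray_integrable (Uk_thorin k) a0 b0 c0).
    have -> : (\int[Uk k]_(v in pos_orthant R 1) f (v 0 0 *: w k)%R =
        \int[Uk k]_(v in pos_orthant R 1)
          (Num.sqrt (a * (v : 'rV[R]_1) 0 0 + b) / c)%:E)%E.
      apply: eq_integral => v /set_mem v0; rewrite /f.
      by rewrite frakA_frakD_ray //; exact: v0.
    by [].
  have int0 k : (0 <= \int[Uk k]_(v in pos_orthant R 1) f (v 0 0 *: w k)%R)%E.
    by apply: integral_ge0 => v _; rewrite lee_fin frakA_frakD_ge0.
  split=> [sumoo k|alloo].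
    apply/ray; apply: le_lt_trans sumoo.
    by rewrite (bigD1 k) //= leeDl // sume_ge0.
  by apply: lte_sum_pinfty => k _; apply/ray.
Qed.
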